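(* Let $A\in\mathbb{R}^{d\times d}$ be symmetric positive definite, $b\in\mathbb{R}^d$ and $f(x)=\frac12x^\top Ax-b^\top x$. Consider Parallel Frictionless Coordinate Hamiltonian Descent applied to $f$ with integration times $\{\eta_{k,i}\}$. (1) If $\eta_{k,i}=\frac{1}{\sqrt{A_{i,i}}}\sin^{-1}(1)$ for all $k$ and $i$, then Parallel Frictionless Coordinate Hamiltonian Descent is the Jacobi method, i.e. from any common initial point $x_1$ the two methods generate the same iterates. (2) If $c$ is a parameter and $\eta_{k,i}=\frac{1}{\sqrt{A_{i,i}}}\cos^{-1}(1-c)$ for all $k$ and $i$, then Parallel Frictionless Coordinate Hamiltonian Descent is the weighted Jacobi method with parameter $c$, i.e. from any common initial point $x_1$ the two methods generate the same iterates.
   Context: Notation: $\sin^{-1}(1)$ denotes any $\theta\in\mathbb{R}$ with $\sin\theta=1$, and $\cos^{-1}(1-c)$ any $\theta\in\mathbb{R}$ with $\cos\theta=1-c$ (so $c$ is a real number for which such $\theta$ exists). $x[i]$ is the $i$-th entry of $x$. Coordinate Hamiltonian Flow: $\mathsf{HF}^{(i)}_t(x_0,0)=(x_t,v_t)$ is the value at time $t$ of the solution of $\frac{dx}{dt}=v$, $\frac{dv}{dt}=-[\nabla f(x)]_i$ with $x(0)=x_0$, $v(0)=0$, where $[\nabla f(x)]_i\in\mathbb{R}^d$ is $\nabla f(x)$ with all entries except the $i$-th replaced by $0$. Parallel Frictionless Coordinate Hamiltonian Descent: from $x_1$, for $k=1,2,\dots$: for each $i\in\{1,\dots,d\}$ (in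 parallel) compute $(x_k^{(i)},v_k^{(i)})=\mathsf{HF}^{(i)}_{\eta_{k,i}}(x_k,0)$ and set $x_{k+1}[i]=x_k^{(i)}[i]$. Let $\zeta_{k,i}:=\frac{b_i-\sum_{j\ne i}A_{i,j}x_k[j]}{A_{i,i}}$. Jacobi method: $x_{k+1}[i]=\zeta_{k,i}$ for all $i$. Weighted Jacobi method with parameter $c$: $x_{k+1}[i]=c\,\zeta_{k,i}+(1-c)x_k[i]$ for all $i$. *)

(* Defs.v *)
(* MathComp-Analysis, over an arbitrary [R : realType]; R^d is ['cV[R]_d]. *)
From mathcomp Require Import all_boot all_order all_algebra.
From mathcomp Require Import all_classical all_reals all_analysis.
Set Implicit Arguments.
Unset Strict Implicit.
Unset Printing Implicit Defensive.
Import Order.TTheory GRing.Theory Num.Theory.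
Import numFieldNormedType.Exports.
Local Open Scope ring_scope.

Definition sym_posdef (R : realType) (d : nat) (A : 'M[R]_d) : Prop :=
  A^T = A /\ forall x : 'cV[R]_d, x != 0 -> 0 < (x^T *m A *m x) 0 0.

Definition quad (R : realType) (d : nat) (A : 'M[R]_d) (b x : 'cV[R]_d) : R :=
  2^-1 * (x^T *m A *m x) 0 0 - (b^T *m x) 0 0.

Definition gradient (R : realType) (d : nat) (f : 'cV[R]_d -> R)
    (x : 'cV[R]_d) : 'cV[R]_d :=
  \col_i 'D_(delta_mx i 0) f x.

Definition coord_gradient (R : realType) (d : nat) (f : 'cV[R]_d -> R)
    (i : 'I_d) (x : 'cV[R]_d) : 'cV[R]_d :=
  \col_j (if j == i then gradient f x j 0 else 0).

Definition coord_hamiltonian_solution (R : realType) (d : nat)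
    (f : 'cV[R]_d -> R) (i : 'I_d) (X V : R -> 'cV[R]_d) : Prop :=
  forall t : R, is_derive t 1 X (V t) /\
                is_derive t 1 V (- coord_gradient f i (X t)).

(* The graph of the flow map: [coord_HF f i t (x0, v0) (xt, vt)] says that
   (xt, vt) is the value at time t of a solution, defined for all times of
   either sign, that starts at (x0, v0). *)
Definition coord_HF (R : realType) (d : nat) (f : 'cV[R]_d -> R) (i : 'I_d)
    (t : R) (z0 zt : 'cV[R]_d * 'cV[R]_d) : Prop :=
  exists X V : R -> 'cV[R]_d,
    [/\ coord_hamiltonian_solution f i X V, (X 0, V 0) = z0 & (X t, V t) = zt].

(* The predicates on sequences below index iterates from 1; the values
   [x 0] and [eta 0] are unused. *)
Definition parallel_CHD (R : realType) (d : nat) (f : 'cV[R]_d -> R)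
    (eta : nat -> 'I_d -> R) (x1 : 'cV[R]_d) (x : nat -> 'cV[R]_d) : Prop :=
  x 1%N = x1 /\
  forall k : nat, (1 <= k)%N -> forall i : 'I_d,
    exists xi vi : 'cV[R]_d,
      coord_HF f i (eta k i) (x k, 0) (xi, vi) /\ x k.+1 i 0 = xi i 0.

Definition zeta (R : realType) (d : nat) (A : 'M[R]_d) (b x : 'cV[R]_d)
    (i : 'I_d) : R :=
  (b i 0 - \sum_(j < d | j != i) A i j * x j 0) / A i i.

Definition jacobi (R : realType) (d : nat) (A : 'M[R]_d) (b x1 : 'cV[R]_d)
    (x : nat -> 'cV[R]_d) : Prop :=
  x 1%N = x1 /\
  forall k : nat, (1 <= k)%N -> forall i : 'I_d, x k.+1 i 0 = zeta A b (x k) i.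

Definition weighted_jacobi (R : realType) (d : nat) (A : 'M[R]_d)
    (b : 'cV[R]_d) (c : R) (x1 : 'cV[R]_d) (x : nat -> 'cV[R]_d) : Prop :=
  x 1%N = x1 /\
  forall k : nat, (1 <= k)%N -> forall i : 'I_d,
    x k.+1 i 0 = c * zeta A b (x k) i + (1 - c) * x k i 0.

(* Main.v *)
(* For quadratic f, the flow in coordinate i freezes the other coordinates,
   and x[i] - zeta_i solves u'' = - A_ii u with u'(0) = 0.  Hence
   x_t[i] = zeta_i + cos (sqrt A_ii * t) * (x_0[i] - zeta_i), uniquely.
   At t = theta / sqrt A_ii this is the weighted Jacobi update with parameter
   1 - cos theta; sin theta = 1 forces cos theta = 0, the Jacobi update. *)
Require Import Defs.
From mathcomp Require Import all_boot all_order all_algebra.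
From mathcomp Require Import all_classical all_reals all_analysis.
From mathcomp Require Import ring.
Import Order.TTheory GRing.Theory Num.Theory.
Import numFieldNormedType.Exports.
Local Open Scope ring_scope.

(** Lets the vector-valued flow equations be handled one scalar coordinate at a time. *)
Lemma is_derive_mxP (R : realFieldType) (V : normedModType R) (m n : nat)
    (M : V -> 'M[R]_(m, n)) (t v : V) (dM : 'M[R]_(m, n)) :
  is_derive t v M dM <->
  forall i j, is_derive t v (fun s => M s i j : R) (dM i j).
Proof.
split=> [[Mtv <-] i j|MtV].
  split; first exact: (derivable_mxP M t v).1.
  by rewrite derive_mx// mxE.
have Mtv : derivable M t v by apply/derivable_mxP => i j; case: (MtV i j).
split=> //; rewrite derive_mx//.
by apply/matrixP => i j; rewrite mxE derive_val.
Qed.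

(** Symmetry of [A] merges the two cross terms of the expansion. The factor [h] is pulled out so
    that the difference quotient becomes affine in [h]. *)
Lemma quad_line (R : realType) (d : nat) (A : 'M[R]_d) (b x v : 'cV[R]_d)
    (h : R) : A^T = A ->
  quad A b (h *: v + x) - quad A b x =
  h * ((v^T *m (A *m x - b)) 0 0 + h * (2^-1 * (v^T *m A *m v) 0 0)).
Proof.
move=> Asym; rewrite /quad.
have trS (u w : 'cV[R]_d) : (u^T *m w) 0 0 = (w^T *m u) 0 0.
  by rewrite -[in RHS](trmxK u) -trmx_mul [RHS]mxE.
have sA : (x^T *m A *m v) 0 0 = (v^T *m A *m x) 0 0.
  by rewrite -mulmxA trS trmx_mul Asym.
have mxD00 (M N : 'M[R]_1) : (M + N) 0 0 = M 0 0 + N 0 0 by rewrite mxE.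
have mxN00 (M : 'M[R]_1) : (- M) 0 0 = - M 0 0 by rewrite mxE.
have mxZ00 k (M : 'M[R]_1) : (k *: M) 0 0 = k * M 0 0 by rewrite mxE.
rewrite [(_ + _)^T]linearD /= [(h *: v)^T]linearZ /=.
rewrite !(mulmxDl, mulmxDr, mulmxN) -!(scalemxAl, scalemxAr) !mulmxA.
by rewrite !(mxD00, mxN00, mxZ00) sA (trS b v); field.
Qed.

Lemma gradient_quad (R : realType) (d : nat) (A : 'M[R]_d) (b x : 'cV[R]_d) :
  A^T = A -> gradient (quad A b) x = A *m x - b.
Proof.
move=> Asym; apply/colP => i; rewrite mxE.
set v := delta_mx i 0.
have -> : (A *m x - b) i 0 = (v^T *m (A *m x - b)) 0 0.
  by rewrite trmx_delta -rowE [RHS]mxE.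
rewrite /derive; apply: cvg_lim => //.
set p := (v^T *m (A *m x - b)) 0 0; set q := 2^-1 * (v^T *m A *m v) 0 0.
have cvg_q : (p + h * q @[h --> (0 : R)^'] --> p)%classic.
  rewrite -[X in (_ --> X)%classic]addr0 -[X in _ + X](mul0r q).
  by apply: cvgD; [exact: cvg_cst|apply: cvgMl; exact: cvg_within].
(* For [h != 0] the difference quotient is exactly [p + h * q], and the limit is taken over the
   punctured neighbourhood. *)
apply: cvg_trans cvg_q; apply: near_eq_cvg; near=> h.
have h0 : h != 0 by near: h; exact: nbhs_dnbhs_neq.
by rewrite /= quad_line// /GRing.scale/= mulKf.
Unshelve. all: by end_near. Qed.

Lemma is_derive_mull (R : numFieldType) (w s : R) : is_derive s 1 ( *%R w) w.
Proof.
by apply: is_derive_eq (is_deriveZ w (is_derive_id s 1)) _; exact: mulr1.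
Qed.

Lemma is_derive_cosM (R : realType) (w s : R) :
  is_derive s 1 (cos \o *%R w) (- sin (w * s) * w).
Proof. exact: is_derive1_comp (is_derive_cos _) (@is_derive_mull R w s). Qed.

Lemma is_derive_sinM (R : realType) (w s : R) :
  is_derive s 1 (sin \o *%R w) (cos (w * s) * w).
Proof. exact: is_derive1_comp (is_derive_sin _) (@is_derive_mull R w s). Qed.

(* [u cos - (v/w) sin] and [u sin + (v/w) cos] are first integrals. *)
Lemma harmonic_cos (R : realType) (w : R) (u v : R -> R) : w != 0 ->
  (forall t : R, is_derive t 1 u (v t)) ->
  (forall t : R, is_derive t 1 v (- (w ^+ 2 * u t))) ->
  v 0 = 0 -> forall t : R, u t = cos (w * t) * u 0.
Proof.
move=> w0 du dv v0 t.
have dc := @is_derive_cosM R w; have ds := @is_derive_sinM R w.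
pose c s := cos (w * s); pose sn s := sin (w * s).
have P : u t * c t - w^-1 * (v t * sn t) = u 0 * c 0 - w^-1 * (v 0 * sn 0).
  apply: (@is_derive_0_is_cst _ (fun s => u s * c s - w^-1 * (v s * sn s))).
  move=> s; apply: is_derive_eq (is_deriveB (is_deriveM (du s) (dc s))
    (is_deriveZ w^-1 (is_deriveM (dv s) (ds s)))) _.
  by rewrite /GRing.scale/= /c /sn; field.
have Q : u t * sn t + w^-1 * (v t * c t) = u 0 * sn 0 + w^-1 * (v 0 * c 0).
  apply: (@is_derive_0_is_cst _ (fun s => u s * sn s + w^-1 * (v s * c s))).
  move=> s; apply: is_derive_eq (is_deriveD (is_deriveM (du s) (ds s))
    (is_deriveZ w^-1 (is_deriveM (dv s) (dc s)))) _.
  by rewrite /GRing.scale/= /c /sn; field.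
move: P Q; rewrite v0 !mul0r !mulr0 subr0 addr0 /c /sn !mulr0 cos0 sin0.
rewrite mulr1 mulr0 => P Q.
rewrite -[LHS]mulr1 -(cos2Dsin2 (w * t)) -P.
(* The middle expression is arranged to contain the second integral, which vanishes by [Q]; what
   remains is [cos (w * t)] times the first integral. *)
transitivity (u t * cos (w * t) ^+ 2 + sin (w * t) *
  (u t * sin (w * t) + w^-1 * (v t * cos (w * t)))
  - sin (w * t) * (w^-1 * (v t * cos (w * t)))); first by ring.
by rewrite Q; ring.
Qed.

(** The [i]-th entry of [A *m x - b] is affine in [x i 0] with slope [A i i] and root [zeta], so the
    force is that of a spring centred at [zeta]. *)
Lemma coord_gradient_quad (R : realType) (d : nat) (A : 'M[R]_d)
    (b x : 'cV[R]_d) (i : 'I_d) : A^T = A -> A i i != 0 ->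
  coord_gradient (quad A b) i x =
  (A i i * (x i 0 - zeta A b x i)) *: delta_mx i 0.
Proof.
move=> Asym Aii; rewrite /coord_gradient gradient_quad//.
apply/colP => j; rewrite !mxE eqxx andbT.
case: eqP => [->|_]; last by rewrite mulr0.
by rewrite mulr1 (bigD1 i)//= /zeta; field.
Qed.

(** The sum in [zeta] skips index [i]; hence the centre of oscillation stays put while only
    coordinate [i] moves. *)
Lemma eq_zeta (R : realType) (d : nat) (A : 'M[R]_d) (b x y : 'cV[R]_d)
    (i : 'I_d) : (forall j, j != i -> x j 0 = y j 0) ->
  zeta A b x i = zeta A b y i.
Proof.
move=> xy; rewrite /zeta; congr ((_ - _) / _).
by apply: eq_bigr => j ji; rewrite xy.
Qed.

(** As [coord_HF] is a relation, the equivalence carries two facts: every solution ends at the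
    stated value (left to right), and a solution exists (right to left). *)
Lemma coord_HF_quad (R : realType) (d : nat) (A : 'M[R]_d)
    (b x : 'cV[R]_d) (i : 'I_d) (t y : R) : A^T = A -> 0 < A i i ->
  (exists xi vi : 'cV[R]_d,
     coord_HF (quad A b) i t (x, 0) (xi, vi) /\ y = xi i 0) <->
  y = zeta A b x i + cos (Num.sqrt (A i i) * t) * (x i 0 - zeta A b x i).
Proof.
move=> Asym Aii; set w := Num.sqrt (A i i); set z := zeta A b x i.
have w0 : w != 0 by rewrite gt_eqF// sqrtr_gt0.
have ww : w ^+ 2 = A i i by rewrite sqr_sqrtr// ltW.
have Aii0 : A i i != 0 by rewrite gt_eqF.
split=> [[xi [vi [[X [V [sol [X0 V0] [Xt _]]]] ->]]]|->].
  have dX (s : R) k : is_derive s 1 (fun s => X s k 0) (V s k 0).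
    by case: (sol s) => /is_derive_mxP/(_ k 0).
  have dV (s : R) k : is_derive s 1 (fun s => V s k 0)
      (- ((A i i * (X s i 0 - zeta A b (X s) i)) *: delta_mx i 0 : 'cV_d) k 0).
    case: (sol s) => _ /is_derive_mxP/(_ k 0).
    by rewrite coord_gradient_quad// mxE.
  (* Off coordinate [i] the acceleration is zero, so the velocity keeps its initial value 0, and
     therefore the position is constant. *)
  have frozen s j : j != i -> X s j 0 = x j 0.
    move=> ji; rewrite -X0.
    apply: (@is_derive_0_is_cst _ (fun s => X s j 0)) => {}s.
    apply: is_derive_eq (dX s j) _.
    have -> : V s j 0 = V 0 j 0; last by rewrite V0 mxE.
    apply: (@is_derive_0_is_cst _ (fun s => V s j 0)) => {}s.
    apply: is_derive_eq (dV s j) _.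
    by rewrite !mxE (negbTE ji)/= mulr0 oppr0.
  have zX s : zeta A b (X s) i = z by apply: eq_zeta => j; exact: frozen.
  have osc : X t i 0 - z = cos (w * t) * (X 0 i 0 - z).
    apply: (@harmonic_cos _ w (fun s => X s i 0 - z) (fun s => V s i 0)) => //.
    - move=> s.
      apply: is_derive_eq (is_deriveB (dX s i) (is_derive_cst z s 1)) _.
      exact: subr0.
    - move=> s; apply: is_derive_eq (dV s i) _.
      by rewrite !mxE !eqxx mulr1 zX ww.
    - by rewrite V0 mxE.
  by rewrite -Xt -X0 -osc addrC subrK.
(* Existence: the explicit cosine motion along the [i]-th axis, written as a displacement from [x]
   that vanishes at time 0, together with its velocity. *)
set u0 := x i 0 - z.
have dc := @is_derive_cosM R w; have ds := @is_derive_sinM R w.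
pose X s : 'cV[R]_d := x + ((cos (w * s) - 1) * u0) *: delta_mx i 0.
pose V s : 'cV[R]_d := (- (w * sin (w * s) * u0)) *: delta_mx i 0.
have Xii s : X s i 0 = z + cos (w * s) * u0.
  by rewrite !mxE !eqxx /= mulr1 /u0; ring.
have zX s : zeta A b (X s) i = z.
  by apply: eq_zeta => j ji; rewrite !mxE (negbTE ji)/= mulr0 addr0.
exists (X t), (V t); split; last by rewrite Xii.
exists X, V; split => //; last first.
  by rewrite /X /V mulr0 cos0 sin0 subrr mulr0 !mul0r oppr0 !scale0r addr0.
move=> s; split; apply/is_derive_mxP => k l; rewrite (ord1 l).
  pose a := u0 * (delta_mx i 0 : 'cV[R]_d) k 0.
  have -> : (fun s => X s k 0) = (cst (x k 0 - a) + a \*: (cos \o *%R w))%R.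
    by apply/funext => r; rewrite !fctE/= !mxE /GRing.scale/= /a mxE; ring.
  apply: is_derive_eq
    (is_deriveD (is_derive_cst (x k 0 - a) s 1) (is_deriveZ a (dc s))) _.
  by rewrite !mxE /GRing.scale/= /a mxE; ring.
pose a := - (w * u0) * (delta_mx i 0 : 'cV[R]_d) k 0.
have -> : (fun s => V s k 0) = (a \*: (sin \o *%R w))%R.
  by apply/funext => r; rewrite !fctE/= !mxE /GRing.scale/= /a mxE; ring.
apply: is_derive_eq (is_deriveZ a (ds s)) _.
rewrite coord_gradient_quad// zX Xii -ww.
by rewrite !mxE /GRing.scale/= /a mxE; ring.
Qed.

(** Test the quadratic form on the [i]-th basis vector. This makes the frequency [Num.sqrt (A i i)]
    positive. *)
Lemma sym_posdef_diag_gt0 (R : realType) (d : nat) (A : 'M[R]_d) (i : 'I_d) :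
  sym_posdef A -> 0 < A i i.
Proof.
move=> [_ /(_ (delta_mx i 0))]; rewrite trmx_delta -rowE -colE !mxE; apply.
by apply/eqP => /colP/(_ i); rewrite !mxE !eqxx => /eqP; rewrite oner_eq0.
Qed.

Theorem theorem7 (R : realType) (d : nat) (A : 'M[R]_d) (b : 'cV[R]_d)
    (hA : sym_posdef A) :
  (forall eta : nat -> 'I_d -> R,
     (forall (k : nat) (i : 'I_d), (1 <= k)%N ->
        exists theta : R,
          sin theta = 1 /\ eta k i = 1 / Num.sqrt (A i i) * theta) ->
     forall (x1 : 'cV[R]_d) (x : nat -> 'cV[R]_d),
       parallel_CHD (quad A b) eta x1 x <-> jacobi A b x1 x)
  /\
  (forall (c : R) (eta : nat -> 'I_d -> R),
     (forall (k : nat) (i : 'I_d), (1 <= k)%N ->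
        exists theta : R,
          cos theta = 1 - c /\ eta k i = 1 / Num.sqrt (A i i) * theta) ->
     forall (x1 : 'cV[R]_d) (x : nat -> 'cV[R]_d),
       parallel_CHD (quad A b) eta x1 x <-> weighted_jacobi A b c x1 x).
Proof.
(* Part (2) comes first; part (1) is its instance [c = 1]. *)
have weighted (c : R) (eta : nat -> 'I_d -> R) :
    (forall (k : nat) (i : 'I_d), (1 <= k)%N ->
      exists theta : R,
        cos theta = 1 - c /\ eta k i = 1 / Num.sqrt (A i i) * theta) ->
    forall (x1 : 'cV[R]_d) (x : nat -> 'cV[R]_d),
      parallel_CHD (quad A b) eta x1 x <-> weighted_jacobi A b c x1 x.
  move=> heta x1 x.
  (* The two update rules are equivalent for each [k] and [i] separately, for an arbitrary sequence
     [x], so no induction on [k] is needed. *)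
  have step k i : (1 <= k)%N ->
      (exists xi vi : 'cV[R]_d,
        coord_HF (quad A b) i (eta k i) (x k, 0) (xi, vi) /\
        x k.+1 i 0 = xi i 0) <->
      x k.+1 i 0 = c * zeta A b (x k) i + (1 - c) * x k i 0.
    move=> k1; have Aii := @sym_posdef_diag_gt0 R d A i hA.
    have [theta [cos_theta ->]] := heta k i k1.
    have := @coord_HF_quad _ _ A b (x k) i (1 / Num.sqrt (A i i) * theta)
      (x k.+1 i 0) (proj1 hA) Aii.
    rewrite mul1r mulVKf ?gt_eqF ?sqrtr_gt0// cos_theta.
    by have -> : forall z u : R, z + (1 - c) * (u - z) = c * z + (1 - c) * u
      by move=> z u; ring.
  by split=> -[x1E H]; split=> // k k1 i; apply/step => //; exact: H.
split=> // eta heta x1 x.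
have -> : jacobi A b x1 x <-> weighted_jacobi A b 1 x1 x.
  split=> -[x1E H]; split=> // k k1 i;
  by rewrite (H k k1 i) subrr mul0r mul1r addr0.
apply: weighted => k i k1; have [theta [s1 ->]] := heta k i k1.
exists theta; split=> //; rewrite subrr; apply/eqP.
by rewrite -sqrf_eq0 cos2sin2 s1 expr1n subrr.
Qed.
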